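(* Every reflection in a Cayley-Klein space is a motion of the space.
   Context: Conventions. Subspaces are projective subspaces, including $\varnothing$ (of dimension $-1$) and the whole space; $\dim$ is projective dimension; $S+T$ is the smallest subspace containing $S$ and $T$; a point $X$ is identified with $\{X\}$. A hyperplane of a subspace $S$ is a subspace of $S$ of dimension $\dim S-1$. A set of points is independent if representing vectors are linearly independent; a set of hyperplanes is independent if the linear forms defining them are linearly independent. The intersection of the empty family of hyperplanes is the whole space. Quadrics. A quadric $Q$ in a real projective space $P(V)$ is the set $\{[x] : f(x,x)=0\}$ for a symmetric bilinear form $f$ on $V$ that is not identically zero; it is considered together with $f$ (up to a nonzero scalar). Points $[x],[y]$ are conjugate with respect to $Q$ if $f(x,y)=0$. The polar of a subspace $K$ with respect to $Q$ is the set of all points of $P(V)$ conjugate to every point of $K$. The vertex of $Q$ is the polar of $P(V)$; $Q$ is non-degenerate if its vertex is empty. Cayley-Klein space. Put $A_0=P^n(\mathbb{R})$. A Cayley-Klein space of dimension $n$ is $P^n(\mathbb{R})$ with a sequence $Q_0,A_1,Q_1,A_2,\dots,A_r,Q_r,A_{r+1}=\varnothing$ such that, for $0\le i\le r$, $Q_i$ is a quadric in $A_i$ with vertex $A_{i+1}$. Its absolute figure is the sequence of complex extensions $\hat Q_0\supseteq\hat A_1\supseteq\hat Q_1\supseteq\cdots\supseteq\hat A_r\supseteq\hat Q_r\supseteq\hat A_{r+1}=\varnothing$. Total polars. If $X$ is a point with $X\in A_l\setminus A_{l+1}$, a total polar of $X$ is a hyperplane of $P^n(\mathbb{R})$ containing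 $X^{p_l}$ (the polar of $X$ in $A_l$ with respect to $Q_l$). If $K$ is a $k$-dimensional subspace, a total polar of $K$ is an $(n-k-1)$-dimensional subspace of the form $\bigcap_{i=0}^k H_i$, where $\{X_0,\dots,X_k\}$ is some independent subset $B$ of $K$ with $|B\cap A_j|=\dim(K\cap A_j)+1$ for $0\le j\le r$, each $H_i$ is a total polar of $X_i$, and $\{H_0,\dots,H_k\}$ is independent. ($P^n(\mathbb{R})$ and $\varnothing$ are total polar to each other.) Reflections. Let $K,K'$ be nonempty disjoint subspaces of $P^n(\mathbb{R})$ with $\dim K+\dim K'=n-1$. For a point $X\notin K\cup K'$ there is a unique line through $X$ meeting both $K$ and $K'$; its intersections with $K$ and $K'$ are the projections of $X$ onto $K$ and onto $K'$. The involution in the pair $(K,K')$ is the collineation of $P^n(\mathbb{R})$ that fixes each point of $K\cup K'$ and maps any other point $X$ to the harmonic conjugate of $X$ with respect to its two projections. If $K$ and $K'$ are total polar to each other with respect to the absolute figure of a Cayley-Klein space, this involution is called the reflection in the pair $(K,K')$. Normal coordinates and motions. Let $n_i=\dim A_i-\dim A_{i+1}$ for $0\le i\le r$. There is a projective coordinate system of $P^n(\mathbb{R})$ (a normal projective coordinate system) such that, writing the coordinate column as $\mathsf X=(\mathsf X_0,\dots,\mathsf X_r)^T$ with blocks $\mathsf X_i\in\mathbb{R}^{n_i}$, $A_i$ is given by $\mathsf X_0=\cdots=\mathsf X_{i-1}=0$ and $Q_i$ is given in $A_i$ by $\mathsf X_i^T\mathsf E_i\mathsf X_i=0$, where $\mathsf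 E_i=\mathrm{diag}(1,\dots,1,-1,\dots,-1)$ is of order $n_i$ (with some number $q_i$ of entries $-1$). A motion of the space is a collineation of $P^n(\mathbb{R})$ which, in normal projective coordinates, is represented (a representing matrix being determined up to a nonzero scalar) by a block lower triangular matrix with diagonal blocks $\mathsf U_0,\dots,\mathsf U_r$, $\mathsf U_i$ of order $n_i$, satisfying $\mathsf U_i^T\mathsf E_i\mathsf U_i=\mathsf E_i$ for $0\le i\le r$, and arbitrary entries below the diagonal blocks. *)

(* Defs.v *)
From HB Require Import structures.
From mathcomp Require Import all_boot all_order all_algebra boolp reals.

Set Implicit Arguments.
Unset Strict Implicit.
Unset Printing Implicit Defensive.

Import Order.TTheory GRing.Theory Num.Theory.
Local Open Scope ring_scope.

(* P^n(R) is the projective space of 'cV[R]_n.+1.  A projective subspace is    *)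
(* the corresponding vector subspace, so the projective dimension of U is      *)
(* \dim U - 1, the empty subspace is 0%VS and the whole space is fullv.        *)
Notation psubspace R n := {vspace 'cV[R]_n.+1}.

Record point (R : realType) (n : nat) := Point {
  point_space :> psubspace R n;
  _ : \dim point_space == 1%N
}.

HB.instance Definition _ (R : realType) (n : nat) :=
  [isSub for @point_space R n].
HB.instance Definition _ (R : realType) (n : nat) :=
  [Choice of point R n by <:].

Definition is_hyperplane (R : realType) (n : nat) (H : psubspace R n) : Prop :=
  \dim H = n.

Definition independent_points (R : realType) (n m : nat)
    (X : 'I_m -> point R n) : Prop :=
  exists x : 'I_m -> 'cV[R]_n.+1,
    (forall i, X i = <[x i]>%VS :> psubspace R n) /\ free [seq x i | i : 'I_m].

Definition independent_hyperplanes (R : realType) (n m : nat)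
    (H : 'I_m -> psubspace R n) : Prop :=
  exists h : 'I_m -> 'Hom('cV[R]_n.+1, R^o),
    (forall i, is_hyperplane (H i) /\ H i = lker (h i))
    /\ free [seq h i | i : 'I_m].

(* Polar of K in U, for a symmetric bilinear form f on U.                      *)
Definition polar (R : realType) (n : nat) (U : psubspace R n)
    (f : {symmetric (subvs_of U)}) (K : psubspace R n) : psubspace R n :=
  (linfun vsval @: orthov f (linfun vsval @^-1: K))%VS.

(* A quadric is carried by its form, which the data below fix only up to the   *)
(* scalars allowed in is_normal_coordinates.  Only A_i for i <= r + 1 and f_i  *)
(* for i <= r are meaningful; the values at larger indices are never used.     *)
Record cayley_klein (R : realType) (n : nat) := CayleyKlein {
  ck_r : nat;
  ck_A : nat -> psubspace R n;
  ck_f : forall i, {symmetric (subvs_of (ck_A i))};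
  ck_A_first : ck_A 0 = fullv;
  ck_A_last : ck_A ck_r.+1 = 0%VS;
  ck_f_neq0 : forall i, (i <= ck_r)%N -> exists x y, ck_f i x y != 0;
  ck_vertex : forall i, (i <= ck_r)%N -> ck_A i.+1 = polar (ck_f i) (ck_A i)
}.

Section TotalPolars.
Context {R : realType} {n : nat}.
Variable C : cayley_klein R n.

Definition is_point_total_polar (X : point R n) (H : psubspace R n) : Prop :=
  is_hyperplane H /\
  exists l : nat, [/\ (l <= ck_r C)%N, (X <= ck_A C l)%VS,
    ~~ (X <= ck_A C l.+1)%VS & (polar (ck_f C l) X <= H)%VS].

(* \dim K is k + 1, so the condition on \dim K' says that the projective       *)
(* dimension of K' is n - k - 1; both sides of the counting condition are      *)
(* likewise projective dimensions plus one.                                    *)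
Definition is_total_polar (K K' : psubspace R n) : Prop :=
  (\dim K' + \dim K = n.+1)%N /\
  exists (X : 'I_(\dim K) -> point R n) (H : 'I_(\dim K) -> psubspace R n),
    [/\ (forall i, (X i <= K)%VS) /\ independent_points X,
        forall j : nat, (j <= ck_r C)%N ->
          #|[set i | (X i <= ck_A C j)%VS]| = \dim (K :&: ck_A C j)%VS,
        forall i, is_point_total_polar (X i) (H i),
        independent_hyperplanes H
      & K' = (\bigcap_(i < \dim K) H i)%VS].

End TotalPolars.

Section Reflections.
Context {R : realType} {n : nat}.

Definition is_projections (K K' : psubspace R n) (X Y Y' : point R n) : Prop :=
  exists L : psubspace R n, [/\ \dim L = 2%N, (X <= L)%VS,
    (L :&: K)%VS = Y & (L :&: K')%VS = Y'].

(* Representing vectors can be chosen so that X = [y + y'] and W = [y - y'].   *)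
Definition is_harmonic_conjugate (Y Y' X W : point R n) : Prop :=
  Y != Y' /\
  exists y y' : 'cV[R]_n.+1,
    [/\ Y = <[y]>%VS :> psubspace R n, Y' = <[y']>%VS :> psubspace R n,
        X = <[y + y']>%VS :> psubspace R n
      & W = <[y - y']>%VS :> psubspace R n].

Definition complementary (K K' : psubspace R n) : Prop :=
  [/\ K != 0%VS, K' != 0%VS, (K :&: K' = 0)%VS
    & (\dim K + \dim K' = n.+1)%N].

(* For complementary K and K' these conditions determine s at every point.     *)
Definition is_involution (K K' : psubspace R n)
    (s : point R n -> point R n) : Prop :=
  (forall X : point R n, (X <= K)%VS || (X <= K')%VS -> s X = X) /\
  (forall X Y Y' : point R n, ~~ (X <= K)%VS -> ~~ (X <= K')%VS ->
     is_projections K K' X Y Y' -> is_harmonic_conjugate Y Y' X (s X)).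

Definition is_reflection (C : cayley_klein R n)
    (s : point R n -> point R n) : Prop :=
  exists K K' : psubspace R n,
    [/\ complementary K K', is_total_polar C K K', is_total_polar C K' K
      & is_involution K K' s].

End Reflections.

Section Motions.
Context {R : realType} {n : nat}.

Definition is_collineation (s : point R n -> point R n) : Prop :=
  bijective s /\
  forall L : psubspace R n, \dim L = 2%N ->
    exists2 L' : psubspace R n, \dim L' = 2%N &
      forall X : point R n, (X <= L)%VS = (s X <= L')%VS.

Definition sign_mx (m q : nat) : 'M[R]_m :=
  diag_mx (\row_(a < m) if (a < m - q)%N then 1 else -1).

Variable C : cayley_klein R n.

(* The orders n_i of the diagonal blocks; their sum is provably n + 1.         *)
Definition ck_n (i : 'I_(ck_r C).+1) : nat :=
  (\dim (ck_A C i) - \dim (ck_A C i.+1))%N.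

(* P maps a vector to its coordinate column.  As Q_i is considered together    *)
(* with its form, saying that Q_i has a given equation means that f_i is a     *)
(* nonzero multiple of the polar form of that equation (over the reals the     *)
(* point set alone would not do: it may be empty).                             *)
Definition is_normal_coordinates (P : 'M[R]_(\sum_i ck_n i, n.+1))
    (q : 'I_(ck_r C).+1 -> nat) : Prop :=
  [/\ row_free P && row_full P,
      forall i, (q i <= ck_n i)%N,
      forall (i : 'I_(ck_r C).+1) (x : 'cV[R]_n.+1),
        x \in ck_A C i <->
        (forall j : 'I_(ck_r C).+1, (j < i)%N -> submxcol (P *m x) j = 0)
    & forall i : 'I_(ck_r C).+1, exists2 c : R, c != 0 &
        forall x y : subvs_of (ck_A C i),
          ck_f C i x y =
          c * ((submxcol (P *m vsval x) i)^T *m sign_mx (ck_n i) (q i)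
                 *m submxcol (P *m vsval y) i) 0 0].

Definition represents (P : 'M[R]_(\sum_i ck_n i, n.+1))
    (M : 'M[R]_(\sum_i ck_n i)) (s : point R n -> point R n) : Prop :=
  forall (X : point R n) (x y : 'cV[R]_n.+1),
    X = <[x]>%VS :> psubspace R n -> s X = <[y]>%VS :> psubspace R n ->
    exists2 c : R, c != 0 & P *m y = c *: (M *m (P *m x)).

(* Two normal coordinate systems differ by a block lower triangular matrix     *)
(* whose diagonal blocks are similitudes U_i^T E_i U_i = c E'_i, so that the   *)
(* condition is the same in each of them; normal_coordinates_exist below shows *)
(* that the quantification over them is not vacuous.                           *)
Definition is_motion (s : point R n -> point R n) : Prop :=
  is_collineation s /\
  forall P q, is_normal_coordinates P q ->
    exists M : 'M[R]_(\sum_i ck_n i),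
      [/\ represents P M s,
          forall i j : 'I_(ck_r C).+1, (i < j)%N -> submxblock M i j = 0
        & forall i : 'I_(ck_r C).+1, let U := submxblock M i i in
            U^T *m sign_mx (ck_n i) (q i) *m U = sign_mx (ck_n i) (q i)].

End Motions.

Lemma orthonormal_basis (R : realType) (vT : vectType R) (f : {symmetric vT})
    (W : {vspace vT}) : (W :&: orthov f W = 0)%VS ->
  exists p m : seq vT, [/\ basis_of W (p ++ m),
    {in p ++ m &, forall u v, u != v -> f u v = 0},
    {in p, forall u, f u u = 1} & {in m, forall u, f u u = -1}].
Proof.
have fC u v : f u v = f v u by rewrite hermC expr0 mul1r.
elim: {W}(\dim W) {-2}W (leqnn (\dim W)) => [|d IH] W.
  rewrite leqn0 dimv_eq0 => /eqP-> _; exists nil, nil; split=> //.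
  exact: nil_basis.
move=> dW W0.
have [/eqP Wz|Wn0] := boolP (W == 0%VS).
  by apply: IH => //; rewrite Wz dimv0.
have [x [xW fx]] : exists x, x \in W /\ f x x != 0.
  pose u := vpick W; have uW : u \in W by rewrite memv_pick.
  have un0 : u != 0 by rewrite vpick0.
  have : u \notin orthov f W.
    apply: contra un0 => uo; rewrite -memv0 -W0.
    by rewrite memv_cap uW.
  case/mem_orthovPn => v vW fuv.
  have [u0|] := eqVneq (f u u) 0; last by exists u.
  have [v0|] := eqVneq (f v v) 0; last by exists v.
  exists (u + v); split; first by rewrite rpredD.
  rewrite !linearDl !linearDr /= u0 v0 addr0 add0r (fC v u).
  by rewrite -mulr2n mulrn_eq0.
pose x1 := (Num.sqrt `|f x x|)^-1 *: x.
have sn0 : Num.sqrt `|f x x| != 0 by rewrite sqrtr_eq0 normr_le0.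
have x1W : x1 \in W by rewrite rpredZ.
have fx1 : f x1 x1 = Num.sg (f x x).
  rewrite /x1 linearZl_LR linearZr_LR /= mulrA -invfM -expr2 sqr_sqrtr //.
  by rewrite {2}[f x x]numEsg mulrCA mulVf ?mulr1 // normr_eq0.
have x1n : f x1 x1 != 0 by rewrite fx1 sgr_eq0.
pose W' := (W :&: orthov f <[x1]>)%VS.
have x1no : x1 \notin orthov f W by apply/mem_orthovPn; exists x1.
have dW' : \dim W' = (\dim W).-1 by rewrite -(eq_dim_orthov1 x1no).
have dWp : (0 < \dim W)%N by rewrite lt0n dimv_eq0.
have Wdec v : v \in W -> exists2 w, w \in W' & exists c : R, v = c *: x1 + w.
  move=> vW; exists (v - (f v x1 / f x1 x1) *: x1).
    rewrite memv_cap rpredB ?rpredZ //= mem_orthov1.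
    by rewrite linearBl linearZl_LR /= divfK // subrr.
  by exists (f v x1 / f x1 x1); rewrite addrC subrK.
have [||p [m [bW' ort fp fm]]] := IH W'.
- by rewrite dW'; case: (\dim W) dW dWp.
- apply/eqP; rewrite -subv0; apply/subvP => v; rewrite memv_cap => /andP[vW' vo].
  rewrite -W0 memv_cap; move: (vW'); rewrite memv_cap => /andP[-> vx] /=.
  apply/mem_orthovP => w /Wdec[w' w'W' [c ->]].
  rewrite linearDr linearZr_LR /=; move: vx; rewrite mem_orthov1 => /eqP->.
  by rewrite mulr0 add0r; move/mem_orthovP: vo; apply.
have sz : size (p ++ m) = \dim W'.
  by rewrite -(size_basis (bW' : basis_of W' (in_tuple _))).
have bWx : basis_of W (x1 :: (p ++ m)).
  rewrite basisEdim /= sz dW' prednK // leqnn andbT.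
  apply/subvP => v /Wdec[w wW' [c ->]]; rewrite span_cons memv_add //.
    by rewrite rpredZ // memv_line.
  by rewrite (span_basis bW').
have inW' u : u \in p ++ m -> u \in W' by apply: basis_mem.
have o1 u : u \in p ++ m -> f u x1 = 0.
  by move/inW'; rewrite memv_cap mem_orthov1 => /andP[_ /eqP].
have ort' s : s =i x1 :: (p ++ m) -> {in s &, forall u v, u != v -> f u v = 0}.
  move=> es u v; rewrite !es !inE => /orP[/eqP->|uI] /orP[/eqP->|vI] uv.
  - by rewrite eqxx in uv.
  - by rewrite fC o1.
  - by rewrite o1.
  - exact: ort.
have [fpos|fneg] := boolP (0 < f x x).
  exists (x1 :: p), m; split=> //; first by apply: ort'.
  by move=> u; rewrite inE => /orP[/eqP->|/fp//]; rewrite fx1 gtr0_sg.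
have pe : perm_eq (p ++ x1 :: m) (x1 :: (p ++ m)).
  by rewrite -[_ :: (p ++ m)]/([:: x1] ++ p ++ m) perm_sym -cat1s perm_catCA.
exists p, (x1 :: m); split=> //.
- by rewrite (perm_basis _ pe).
- by apply: ort'; apply: perm_mem.
- move=> u; rewrite inE => /orP[/eqP->|/fm//]; rewrite fx1 ltr0_sg //.
  by rewrite lt_neqAle fx leNgt.
Qed.

Section NormalCoordinatesExist.
Variables (R : realType) (n : nat) (C : cayley_klein R n).
Local Notation A := (ck_A C).
Local Notation r := (ck_r C).

Lemma polarP i (x : subvs_of (A i)) : (i <= r)%N ->
  vsval x \in A i.+1 = (x \in orthov (ck_f C i) fullv).
Proof.
move=> ir; rewrite ck_vertex // /polar.
have -> : (linfun vsval @^-1: A i)%VS = fullv :> {vspace subvs_of (A i)}.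
  apply/eqP; rewrite eqEsubv subvf; apply/subvP => u _.
  by rewrite -memv_preim lfunE /= subvsP.
apply/memv_imgP/idP => [[u uo]|xo]; last by exists x; rewrite ?lfunE.
by rewrite lfunE => /val_inj ->.
Qed.

Lemma A_sub i : (i <= r)%N -> (A i.+1 <= A i)%VS.
Proof.
move=> ir; rewrite ck_vertex //; apply/subvP => x /memv_imgP[u _ ->].
by rewrite lfunE subvsP.
Qed.

Lemma dim_rad i : (i <= r)%N -> \dim (orthov (ck_f C i) fullv) = \dim (A i.+1).
Proof.
move=> ir; rewrite ck_vertex // /polar limg_dim_eq.
  congr (\dim (orthov _ _)); apply/eqP; rewrite eqEsubv subvf andbT.
  by apply/subvP => u _; rewrite -memv_preim lfunE /= subvsP.
apply/eqP; rewrite -subv0; apply/subvP => u; rewrite memv_cap => /andP[_].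
by rewrite memv_ker lfunE memv0 /= => /eqP u0; apply/eqP/val_inj.
Qed.

Lemma level_basis (i : 'I_r.+1) : exists (b : 'M[R]_(n.+1, ck_n i)) (q : nat),
 [/\ (q <= ck_n i)%N, forall c : 'cV_(ck_n i), b *m c \in A i,
   forall x, x \in A i -> exists c : 'cV_(ck_n i), x - b *m c \in A i.+1
 & forall (x x' : subvs_of (A i)) (c d : 'cV_(ck_n i)),
    vsval x - b *m c \in A i.+1 -> vsval x' - b *m d \in A i.+1 ->
    ck_f C i x x' = (c^T *m sign_mx (ck_n i) q *m d) 0 0].
Proof.
have ir : (i <= r)%N by rewrite -ltnS ltn_ord.
set f := ck_f C i.
have fC u v : f u v = f v u by rewrite hermC expr0 mul1r.
pose N := orthov f fullv; pose W := (N^C)%VS.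
have decW x : exists w z, [/\ w \in W, z \in N & x = z + w].
  have : x \in (N + N^C)%VS by rewrite addv_complf memvf.
  by case/memv_addP=> z zN [w wW ->]; exists w, z.
have fN z x : z \in N -> f z x = 0 by move/mem_orthovP; apply; rewrite memvf.
have [|p [m [bs ort fp fm]]] := @orthonormal_basis R _ f W.
  apply/eqP; rewrite -subv0; apply/subvP => v; rewrite memv_cap => /andP[vW vo].
  rewrite -(capv_compl N) memv_cap vW andbT; apply/mem_orthovP => x _.
  have [w [z [wW zN ->]]] := decW x.
  by rewrite linearDr /= fC fN // add0r; move/mem_orthovP: vo; apply.
set s := p ++ m in bs ort.
have sz : size s = ck_n i.
  rewrite -(size_basis (bs : basis_of W (in_tuple _))) /W dimv_compl dim_rad //.
  by rewrite dimvf.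
have us : uniq s by apply: free_uniq; apply: basis_free bs.
have spm : (size p + size m)%N = ck_n i by rewrite -sz size_cat.
pose b : 'M[R]_(n.+1, ck_n i) := \matrix_(j, a) (vsval s`_a) j 0.
have bE c : b *m c = vsval (\sum_a c a 0 *: s`_a).
  apply/matrixP => j k; rewrite !mxE linear_sum summxE; apply: eq_bigr => a _.
  by rewrite linearZ !mxE ord1 mulrC.
have sE x : x \in W -> exists c : 'cV_(ck_n i), x = \sum_a c a 0 *: s`_a.
  move=> xW; have xs : x \in <<in_tuple s>>%VS by rewrite (span_basis bs).
  exists (\col_a coord (in_tuple s) (cast_ord (esym sz) a) x).
  rewrite {1}(coord_span xs) (reindex (cast_ord (esym sz))) /=; last first.
    by exists (cast_ord sz) => j _; apply/val_inj.
  by apply: eq_bigr => a _; rewrite mxE.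
exists b, (size m); split.
- by rewrite -spm leq_addl.
- by move=> c; rewrite bE subvsP.
- move=> x xA; have [w [z [/sE[c ->] zN xe]]] := decW (Subvs xA).
  by exists c; rewrite bE -[x]/(vsval (Subvs xA)) xe -linearB addrK polarP.
move=> x x' c d; rewrite !bE -!linearB !polarP // => xN xN'.
have fx (u v t: subvs_of (A i)) : u - v \in N -> f u t = f v t.
  by move=> /fN-/(_ t); rewrite linearBl => /eqP; rewrite subr_eq0 => /eqP.
rewrite (fx _ _ _ xN) fC (fx _ _ _ xN').
rewrite linear_sumr mxE; apply: eq_bigr => a _.
rewrite linearZr_LR /=; set v := (X in f X _); rewrite -/(f v s`_a) fC linear_sumr /= mul_mx_diag !mxE -mulrA; congr (_ * _).
rewrite (bigD1 a) //= big1 => [|a' na]; last first.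
  rewrite linearZr_LR /= ort ?mulr0 ?mem_nth ?sz //.
  by rewrite nth_uniq ?sz // eq_sym.
rewrite addr0 linearZr_LR /= mulrC; congr (_ * _).
have am : (a < size p + size m)%N by rewrite spm.
have -> : (ck_n i - size m)%N = size p by rewrite -spm addnK.
rewrite nth_cat; case: ltnP => ap; [rewrite fp|rewrite fm] => //; rewrite mem_nth //.
by rewrite ltn_subLR.
Qed.

Lemma sum_ck_n : (\sum_i @ck_n R n C i)%N = n.+1.
Proof.
have H k : (k <= r.+1)%N ->
    (\sum_(i < k) (\dim (A i) - \dim (A i.+1)) + \dim (A k))%N = n.+1.
  elim: k => [_|k IH kr]; first by rewrite big_ord0 ck_A_first dimvf /dim /= muln1.
  apply: etrans (IH (ltnW kr)); rewrite big_ord_recr /= -addnA subnK //.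
  exact/dimvS/A_sub.
by have := H _ (leqnn _); rewrite ck_A_last dimv0 addn0.
Qed.

Lemma normal_coordinates_exist :
  exists (P : 'M[R]_(\sum_i @ck_n R n C i, n.+1)) q, is_normal_coordinates P q.
Proof.
have [b bq0] : exists b : forall i, 'M[R]_(n.+1, @ck_n R n C i),
  forall i, exists q : nat,
 [/\ (q <= ck_n i)%N, forall c : 'cV_(ck_n i), b i *m c \in A i,
   forall x, x \in A i -> exists c : 'cV_(ck_n i), x - b i *m c \in A i.+1
 & forall (x x' : subvs_of (A i)) (c d : 'cV_(ck_n i)),
    vsval x - b i *m c \in A i.+1 -> vsval x' - b i *m d \in A i.+1 ->
    ck_f C i x x' = (c^T *m sign_mx (ck_n i) q *m d) 0 0].
  exists (fun i => projT1 (cid (level_basis i))) => i.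
  exact: (projT2 (cid (level_basis i))).
pose q i := projT1 (cid (bq0 i)); have bq i := projT2 (cid (bq0 i)).
pose B := \mxrow_i b i.
have Asub (i j : nat) : (i <= j <= r.+1)%N -> (A j <= A i)%VS.
  case/andP; elim: j => [|j IH]; first by rewrite leqn0 => /eqP->.
  rewrite leq_eqVlt => /orP[/eqP->//|ij] jr.
  exact: subv_trans (A_sub (jr : (j <= r)%N)) (IH ij (ltnW jr)).
have dec k : (k <= r.+1)%N -> forall x, x \in A (r.+1 - k) ->
   exists c : 'cV_(\sum_i @ck_n R n C i), x = B *m c /\
     forall j : 'I_r.+1, (j < r.+1 - k)%N -> submxcol c j = 0.
  elim: k => [_ x|k IH kr x xA].
    rewrite subn0 ck_A_last memv0 => /eqP->; exists 0.
    by rewrite mulmx0; split=> // j _; rewrite submxcol0.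
  have ir : (r.+1 - k.+1 < r.+1)%N by rewrite subSS ltnS leq_subr.
  pose i := Ordinal ir.
  have ik : (r.+1 - k)%N = i.+1 by rewrite /= subSS subSn.
  have [_ _ /(_ x xA)[c xc] _] := bq i.
  have [|d [xd d0]] := IH (ltnW kr) (x - b i *m c); first by rewrite ik.
  pose e : 'cV_(\sum_i @ck_n R n C i) :=
    \mxcol_j (if j =P i is ReflectT E then castmx (congr1 (@ck_n R n C) (esym E), erefl) c else 0).
  have Be : B *m e = b i *m c.
    rewrite mul_mxrow_mxcol (bigD1 i) //= big1 ?addr0 => [|j ji].
      by case: eqP => // E; rewrite (eq_irrelevance E erefl) castmx_id.
    by case: eqP ji => // _ _; rewrite mulmx0.
  exists (e + d); rewrite mulmxDr Be -xd addrC subrK; split=> // j ji.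
  rewrite submxcolD mxcolK d0 ?addr0; last by rewrite ik ltnS ltnW.
  by case: eqP => // E; rewrite E /= ltnn in ji.
have surj (x : 'cV[R]_n.+1) : exists c, x = B *m c.
  have [|c [-> _]] := dec r.+1 (leqnn _) x; last by exists c.
  by rewrite subnn ck_A_first memvf.
pose P := \matrix_(j, k) projT1 (cid (surj (delta_mx k 0))) j 0.
have BP : B *m P = 1%:M.
  apply/matrixP => j k; rewrite !mxE.
  have /matrixP/(_ j 0) := projT2 (cid (surj (delta_mx k 0))).
  rewrite !mxE eqxx andbT => ->; apply: eq_bigr => l _; by rewrite !mxE.
have Pfull : row_full P by apply/row_fullP; exists B.
have Pfree : row_free P by rewrite /row_free (eqP Pfull) sum_ck_n.
have PB : P *m B = 1%:M.
  by apply: (row_free_inj Pfree); rewrite -mulmxA BP mulmx1 mul1mx.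
have coordB (x : 'cV[R]_n.+1) : x = \sum_j b j *m submxcol (P *m x) j.
  by rewrite -mul_mxrow_mxcol submxcolK mulmxA BP mul1mx.
have bA (j : 'I_r.+1) c : b j *m c \in A j by case: (bq j).
have PA (i : 'I_r.+1) x : x \in A i <->
    (forall j : 'I_r.+1, (j < i)%N -> submxcol (P *m x) j = 0).
  split=> [xA j ji|H].
    have [|c [xc c0]] := dec (r.+1 - i)%N (leq_subr _ _) x.
      by rewrite subKn // ltnW.
    rewrite xc mulmxA PB mul1mx c0 // subKn //; exact: ltnW.
  rewrite [x]coordB; apply: rpred_sum => j _.
  have [ji|ij] := ltnP j i; first by rewrite H // mulmx0 rpred0.
  by apply: subvP (bA j _); apply: Asub; rewrite ij ltnW.
exists P, q; split=> //; first by rewrite Pfree.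
  by move=> i; case: (bq i).
move=> i; exists 1; rewrite ?oner_neq0 // => x y; rewrite mul1r.
have sub (z : subvs_of (A i)) : vsval z - b i *m submxcol (P *m vsval z) i \in A i.+1.
  rewrite {1}[vsval z]coordB (bigD1 i) //= addrAC subrr add0r.
  apply: rpred_sum => j ji; have [lt|ij] := ltnP j i.
    by rewrite (PA i (vsval z)).1 ?subvsP // mulmx0 rpred0.
  apply: subvP (bA j _); apply: Asub; rewrite ltn_neqAle ij eq_sym ji.
  by rewrite /= ltnW.
by case: (bq i) => _ _ _; apply; apply: sub.
Qed.
End NormalCoordinatesExist.

(* Main.v *)
(* The involution in (K, K') is induced by the linear symmetry sigma equal to   *)
(* the identity on K and to its opposite on K'.  Expressed in a single normal   *)
(* coordinate system, being a motion means that sigma preserves every A_l and   *)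
(* every form f_l.  Both follow once each A_l is the sum of its intersections   *)
(* with K and K', and these intersections are f_l-conjugate; disjointness of K  *)
(* and K' forces this as soon as K' is a total polar of K.                      *)

Require Import Defs.
From mathcomp Require Import all_boot all_order all_algebra reals.

Set Implicit Arguments.
Unset Strict Implicit.
Unset Printing Implicit Defensive.

Import Order.TTheory GRing.Theory Num.Theory.
Local Open Scope ring_scope.

(** Take independent points X_i of K adapted to the flag of the A_j, with total polars H_i that
    intersect in K'. If X_i is outside A_l, then A_l lies in the vertex of an earlier quadric, hence
    in H_i; so at most \dim (K :&: A_l) hyperplanes cut K' :&: A_l out of A_l. As K and K' are
    disjoint, A_l is the direct sum of its traces on K and K', and every H_i with X_i in A_l cuts
    A_l properly. If moreover X_i is outside A_(l+1), the trace of H_i on A_l is then the polar of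
    X_i. So the two traces are f_l-conjugate ([total_polar_level]), and sigma preserves each A_l and
    f_l. [involution_symmetry] identifies the involution with sigma; [symmetry_motion] turns these
    invariances into the block form of its matrix. *)

Lemma mulmx_cV_inj (R : nzRingType) (m p : nat) (A B : 'M[R]_(m, p)) :
  (forall v : 'cV_p, A *m v = B *m v) -> A = B.
Proof.
move=> AB; apply/matrixP => i j.
by have /matrixP/(_ i 0) := AB (delta_mx j 0); rewrite -!colE !mxE.
Qed.

Lemma mulmx_bilinear_inj (R : nzRingType) (m p : nat) (A B : 'M[R]_(m, p)) :
  (forall (u : 'cV_m) (v : 'cV_p), (u^T *m A *m v) 0 0 = (u^T *m B *m v) 0 0) ->
  A = B.
Proof.
move=> AB; apply/matrixP => i j; have := AB (delta_mx i 0) (delta_mx j 0).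
by rewrite trmx_delta -!mulmxA -!colE -!rowE !mxE.
Qed.

Lemma linear_mulmx (R : comNzRingType) (m p : nat)
    (f : {linear 'cV[R]_m -> 'cV[R]_p}) :
  exists M : 'M[R]_(p, m), forall v, f v = M *m v.
Proof.
exists (\matrix_(a, b) f (delta_mx b 0) a 0) => v.
rewrite {1}[v]matrix_sum_delta linear_sum; apply/matrixP => a b.
rewrite summxE !mxE; apply: eq_bigr => j _.
by rewrite big_ord1 linearZ !mxE (ord1 b) mulrC.
Qed.

(** Intersecting with one H i lowers the dimension by at most one, and not at all if H i contains
    U. *)
Lemma dim_cap_hyperplanes (K : fieldType) (V : vectType K) (I : finType)
    (U : {vspace V}) (H : I -> {vspace V}) :
  (forall i, \dim {:V} <= (\dim (H i)).+1)%N ->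
  (\dim U <= \dim (U :&: \bigcap_i H i) + #|[set i | ~~ (U <= H i)%VS]|)%N.
Proof.
move=> Hdim; rewrite cardsE cardE /enum_mem size_filter -big_enum /= enumT.
elim: (Finite.enum I) => [|i s IH] /=; first by rewrite big_nil capvf addn0.
rewrite big_cons; apply: leq_trans IH _; set W := (\bigcap_(j <- s) H j)%VS.
rewrite addnA leq_add2r [(H i :&: W)%VS]capvC capvA unfold_in.
have [UH|_] := boolP (U <= H i)%VS.
  have /capv_idPl-> := subv_trans (capvSl U W) UH.
  by rewrite addn0.
rewrite -(leq_add2r (\dim (H i))) -dimv_sum_cap addnC -addnA leq_add2l add1n.
exact: leq_trans (dimvS (subvf _)) (Hdim i).
Qed.

(** * The linear symmetry attached to a direct sum *)

Section Symmetry.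
Variables (F : fieldType) (V : vectType F) (K K' : {vspace V}).

Definition symmetry : 'End(V) := daddv_pi K K' - daddv_pi K' K.

Hypothesis KK0 : (K :&: K' = 0)%VS.

Lemma symmetryE k k' : k \in K -> k' \in K' -> symmetry (k + k') = k - k'.
Proof.
move=> kK kK'; have kk' : k + k' \in (K + K')%VS by apply: memv_add.
rewrite /symmetry add_lfunE opp_lfunE.
have E := daddv_pi_add KK0 kk'.
have d0 : daddv_pi K K' (k + k') - k \in (K :&: K')%VS.
  rewrite memv_cap rpredB ?memv_pi //=.
  have -> : daddv_pi K K' (k + k') - k = k' - daddv_pi K' K (k + k').
    by apply/eqP; rewrite subr_eq addrAC eq_sym subr_eq E addrC.
  by rewrite rpredB ?memv_pi.
move: d0; rewrite KK0 memv0 subr_eq0 => /eqP e; rewrite e in E.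
by rewrite e (addrI _ E).
Qed.

Hypothesis KKT : (K + K' = fullv)%VS.

Lemma symmetryK : involutive symmetry.
Proof.
move=> x; have : x \in (K + K')%VS by rewrite KKT memvf.
case/memv_addP => k kK [k' kK' ->].
by rewrite symmetryE // symmetryE ?rpredN // opprK.
Qed.

End Symmetry.

(** * Splitting and conjugacy at each level of the flag *)

Section TotalPolarPair.
Variables (R : realType) (n : nat) (C : cayley_klein R n).
Variables (K K' : psubspace R n).
Local Notation A := (ck_A C).
Local Notation r := (ck_r C).

Lemma ck_A_antitone i j : (i <= j)%N -> (j <= r.+1)%N -> (A j <= A i)%VS.
Proof.
elim: j => [|j IH]; first by rewrite leqn0 => /eqP->.
rewrite leq_eqVlt => /orP[/eqP->//|ij] jr.
exact: subv_trans (A_sub (jr : (j <= r)%N)) (IH ij (ltnW jr)).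
Qed.

Lemma mem_polar_line l (x y : subvs_of (A l)) :
  (vsval y \in polar (ck_f C l) <[vsval x]>) = (ck_f C l x y == 0).
Proof.
have fC : ck_f C l x y = ck_f C l y x by rewrite hermC expr0 mul1r.
apply/memv_imgP/eqP => [[y' y'x]|xy].
  rewrite lfunE => /val_inj ->; rewrite hermC expr0 mul1r.
  by move/mem_orthovP: y'x; apply; rewrite -memv_preim lfunE /= memv_line.
exists y; last by rewrite lfunE.
apply/mem_orthovP => z; rewrite -memv_preim lfunE /= => /vlineP[k zx].
have -> : z = k *: x by apply/val_inj; rewrite /= zx.
by rewrite linearZr_LR /= -fC xy mulr0.
Qed.

Hypothesis KK0 : (K :&: K' = 0)%VS.
Hypothesis tpK : is_total_polar C K K'.

(* Only the hyperplanes H_i with X_i in A_l can fail to contain A_l, since      *)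
(* otherwise A_l lies in the polar of X_i.  There are \dim (K :&: A_l) of them, *)
(* so counting dimensions in K :&: K' = 0 shows that all of them fail to.       *)
Lemma total_polar_level l : (l <= r)%N ->
  (\dim (A l) <= \dim (K :&: A l) + \dim (K' :&: A l))%N /\
  forall x y : subvs_of (A l), vsval x \in K -> vsval y \in K' ->
    ck_f C l x y = 0.
Proof.
move=> lr; case: tpK => _ [X [H [[XK [x [Xx freex]]] XA XH _ K'H]]].
have xX i : x i \in K by rewrite memvE -Xx XK.
have XAe i j : (X i <= A j)%VS = (x i \in A j) by rewrite Xx memvE.
pose S := [set i | ~~ (A l <= H i)%VS].
pose T := [set i | (X i <= A l)%VS].
have ST : S \subset T.
  apply/subsetP => i; rewrite !inE; apply: contraNT => XAl.
  have [_ [m [mr Xm Xm1]]] := XH i; apply: subv_trans.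
  have ml : (m < l)%N.
    rewrite ltnNge; apply: contra XAl => lm.
    exact: subv_trans Xm (ck_A_antitone lm (leqW mr)).
  (* A_(m+1) is the vertex of Q_m, so all of it is conjugate to X_i. *)
  apply: subv_trans (ck_A_antitone ml (leqW lr)) _.
  rewrite Xx; rewrite XAe in Xm.
  apply/subvP => y yA; have yAm := subvP (A_sub mr) _ yA.
  have := mem_polar_line (Subvs Xm) (Subvs yAm); rewrite /= => ->; apply/eqP.
  rewrite hermC expr0 mul1r.
  have := @polarP R n C m (Subvs yAm) mr; rewrite /= yA => /esym/mem_orthovP.
  by apply; rewrite memvf.
have cT : #|T| = \dim (K :&: A l) by rewrite XA.
have dS : (\dim (A l) <= \dim (K' :&: A l) + #|S|)%N.
  rewrite K'H capvC; apply: dim_cap_hyperplanes => i.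
  have [-> _] := XH i; by rewrite dimvf /dim /= muln1.
have dKK' : (\dim (K :&: A l) + \dim (K' :&: A l) <= \dim (A l))%N.
  rewrite -dimv_disjoint_sum; first by apply: dimvS; rewrite subv_add !capvSr.
  by apply/eqP; rewrite -subv0 -KK0; apply: capvS; apply: capvSl.
(* [dS] and [dKK'] together give #|T| <= #|S|. *)
have eST : S = T.
  apply/eqP; rewrite eqEcard ST cT -(leq_add2r (\dim (K' :&: A l))).
  by rewrite (leq_trans dKK') // addnC.
split; first by rewrite (leq_trans dS) // eST cT addnC.
move=> k y kK yK'.
have conj_basis i (u : subvs_of (A l)) : vsval u = x i -> ck_f C l u y = 0.
  move=> ux; have uA : x i \in A l by rewrite -ux subvsP.
  have [xA1|xA1] := boolP (x i \in A l.+1).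
    move: xA1; rewrite -ux polarP // => /mem_orthovP; apply; exact: memvf.
  have [_ [m [mr Xm Xm1 polH]]] := XH i; rewrite !XAe in Xm Xm1.
  have ml : m = l.
    case: (ltngtP m l) => // [ml|lm].
      by case/negP: Xm1; apply: subvP (ck_A_antitone ml (leqW lr)) _ uA.
    by case/negP: xA1; apply: subvP (ck_A_antitone lm (leqW mr)) _ Xm.
  move: polH; rewrite ml Xx -ux => polH.
  have : i \in S by rewrite eST inE XAe.
  rewrite inE => /subvPn[z zA zH].
  have uz : ck_f C l u (Subvs zA) != 0.
    apply: contra zH; rewrite -mem_polar_line; exact: subvP polH _.
  have yH : vsval y \in H i by move: yK'; rewrite K'H; apply/subvP/bigcapv_inf.
  (* This c makes y - c z conjugate to u, hence a vector of H_i. As y is in H_i and z is not, c must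
     vanish. *)
  pose c := ck_f C l u y / ck_f C l u (Subvs zA).
  have czH : c *: z \in H i.
    rewrite -(rpredBl _ yH) -[_ - _]/(vsval (y - c *: Subvs zA)).
    apply: (subvP polH); rewrite mem_polar_line linearBr linearZr_LR /=.
    by rewrite divfK // subrr.
  have c0 : c = 0.
    by apply: contraNeq zH => cn0; rewrite -[z](scalerK cn0) rpredZ.
  by move/eqP: c0; rewrite mulf_eq0 invr_eq0 (negPf uz) orbF => /eqP.
rewrite hermC expr0 mul1r; apply/eqP; rewrite -mem_polar_line.
(* By the counting condition the x_i lying in A_l form a basis of K :&: A_l, so conjugacy need only
   be checked on them. *)
pose Z := [seq z <- [seq x i | i : 'I_(\dim K)] | z \in A l].
have sZ : size Z = \dim (K :&: A l).
  rewrite -cT cardsE cardE /enum_mem size_filter /Z size_filter count_map.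
  by rewrite -enumT; apply: eq_count => i; exact: esym (XAe _ _).
have spZ : (<<Z>> = K :&: A l)%VS.
  apply/eqP; rewrite eqEdim -sZ; have /eqP-> := filter_free (mem (A l)) freex.
  rewrite leqnn andbT; apply/span_subvP => z.
  by rewrite mem_filter memv_cap => /andP[-> /imageP[i _ ->]]; rewrite xX.
have : vsval k \in <<Z>>%VS by rewrite spZ memv_cap kK subvsP.
apply/subvP/span_subvP => z; rewrite mem_filter => /andP[zA /imageP[i _ zi]].
have := mem_polar_line y (Subvs zA); rewrite /= => ->.
by rewrite hermC expr0 mul1r (conj_basis i).
Qed.

End TotalPolarPair.

(** * The involution as a linear map, and its matrix *)

Section Reflection.
Variables (R : realType) (n : nat) (K K' : psubspace R n).
Local Notation sigma := (symmetry K K').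
Variable s : point R n -> point R n.

Hypothesis KK' : complementary K K'.

Lemma complementary_add : (K + K' = fullv)%VS.
Proof.
case: KK' => _ _ KK0 dKK; apply/eqP; rewrite eqEdim subvf /=.
by rewrite dimv_disjoint_sum // dKK dimvf /dim /= muln1.
Qed.

(** For x = k + k' with both terms nonzero, the line joining [k] and [k'] is the transversal through
    X, so these are its projections and the harmonic conjugate is [k - k']. *)
Lemma involution_symmetry (X : point R n) (x : 'cV[R]_n.+1) :
  is_involution K K' s -> X = <[x]>%VS :> psubspace R n ->
  s X = <[sigma x]>%VS :> psubspace R n.
Proof.
move=> [sfix sharm] Xx; case: (KK') => _ _ KK0 _.
have : x \in (K + K')%VS by rewrite complementary_add memvf.
case/memv_addP => k kK [k' kK' xE].
have [k'0|k'n0] := eqVneq k' 0.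
  have xk : x = k by rewrite xE k'0 addr0.
  rewrite sfix; last by rewrite Xx -memvE xk kK.
  by rewrite Xx xk -[in RHS](addr0 k) symmetryE ?rpred0 // subr0.
have [k0|kn0] := eqVneq k 0.
  have xk' : x = k' by rewrite xE k0 add0r.
  rewrite sfix; last by rewrite Xx -!memvE xk' kK' orbT.
  rewrite Xx xk' -[in RHS](add0r k') symmetryE ?rpred0 // sub0r.
  by apply/eqP; rewrite eqEsubv -!memvE memvN memv_line -memvN memv_line.
have kNK' : k \notin K'.
  apply: contra kn0 => kK'2; by rewrite -memv0 -KK0 memv_cap kK.
have k'NK : k' \notin K.
  apply: contra k'n0 => k'K; by rewrite -memv0 -KK0 memv_cap k'K.
have dk : \dim <[k]> == 1%N by rewrite dim_vline kn0.
have dk' : \dim <[k']> == 1%N by rewrite dim_vline k'n0.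
have XK : ~~ (X <= K)%VS by rewrite Xx -memvE xE rpredDl.
have XK' : ~~ (X <= K')%VS by rewrite Xx -memvE xE rpredDr.
have capL (W W' : psubspace R n) w w' :
    (W :&: W' = 0)%VS -> w \in W -> w' \in W' ->
    ((<[w]> + <[w']>) :&: W = <[w]>)%VS.
  move=> WW0 wW w'W'; apply/eqP.
  rewrite eqEsubv subv_cap addvSl -memvE wW !andbT.
  apply/subvP => z; rewrite memv_cap => /andP[/memv_addP[a /vlineP[c ->]]].
  case=> b /vlineP[c' ->] ->; rewrite rpredDl => [c'W|]; last exact: rpredZ.
  have : c' *: w' \in (W :&: W')%VS by rewrite memv_cap c'W rpredZ.
  by rewrite WW0 memv0 => /eqP->; rewrite addr0 rpredZ ?memv_line.
have [|_ [y [y' [Yy Y'y' Xyy ->]]]] := sharm X (Point dk) (Point dk') XK XK'.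
  exists (<[k]> + <[k']>)%VS; split.
  - rewrite dimv_disjoint_sum ?(eqP dk) ?(eqP dk') //.
    apply/eqP; rewrite -subv0 -KK0; apply/subvP => z; rewrite !memv_cap.
    by case/andP=> /vlineP[c ->] /vlineP[c' e]; rewrite rpredZ // e rpredZ.
  - by rewrite Xx -memvE xE memv_add ?memv_line.
  - exact: capL KK0 kK kK'.
  - by rewrite addvC; apply: capL kK' kK; rewrite capvC.
have yK : y \in K.
  by apply: subvP (memv_line y); rewrite -Yy /= -memvE.
have yK' : y' \in K'.
  by apply: subvP (memv_line y'); rewrite -Y'y' /= -memvE.
(* y and y' may differ from k and k' by a scalar; only the line spanned by y + y' matters. *)
rewrite -(symmetryE KK0 yK yK').
have yx : (<[y + y']> = <[x]>)%VS by rewrite -Xyy.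
by rewrite -!limg_line yx.
Qed.

Lemma involution_collineation : is_involution K K' s -> is_collineation s.
Proof.
move=> inv; case: (KK') => _ _ KK0 _.
have sK := symmetryK KK0 complementary_add.
have gen (X : point R n) : exists x, X = <[x]>%VS :> psubspace R n.
  exists (vpick X); apply/eqP; rewrite eq_sym eqEdim -memvE memv_pick.
  by rewrite (eqP (valP X)) dim_vline vpick0 -dimv_eq0 (eqP (valP X)).
have sE := fun X x => @involution_symmetry X x inv.
have ss : involutive s.
  move=> X; have [x Xx] := gen X; apply/val_inj => /=.
  by rewrite (sE _ _ (sE _ _ Xx)) sK Xx.
split; first by exists s.
have lk0 : lker sigma == 0%VS.
  by apply/lker0P; apply: can_inj sK.
move=> L dL; exists (sigma @: L)%VS.
  by rewrite limg_dim_eq // (eqP lk0) capv0.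
move=> X; have [x Xx] := gen X; rewrite Xx (sE _ _ Xx) -limg_line.
by rewrite limg_ker0.
Qed.

Variable C : cayley_klein R n.
Hypothesis symA : forall i x, (i <= ck_r C)%N -> x \in ck_A C i ->
  sigma x \in ck_A C i.
Hypothesis symf : forall i (x x' y y' : subvs_of (ck_A C i)),
  (i <= ck_r C)%N -> vsval x' = sigma (vsval x) -> vsval y' = sigma (vsval y) ->
  ck_f C i x' y' = ck_f C i x y.

(** Columns supported in block i represent vectors of A_i. Invariance of A_i kills the blocks of M
    above the diagonal, and invariance of f_i on such columns is the condition on the diagonal
    block. *)
Lemma symmetry_motion : is_involution K K' s -> is_motion C s.
Proof.
move=> inv; split; first exact: involution_collineation.
move=> P q [/andP[Pfree Pfull] _ PA Pf].
have [B BP] := row_fullP Pfull.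
have PB : P *m B = 1%:M.
  by apply: (row_free_inj Pfree); rewrite -mulmxA BP mulmx1 mul1mx.
have [S SE] := linear_mulmx sigma.
pose M := P *m S *m B.
have MP x : M *m (P *m x) = P *m sigma x.
  by rewrite /M -!mulmxA (mulmxA B) BP mul1mx SE.
(* The column with v in block i and zero elsewhere; the cast only adjusts the block size along i =
   j. *)
pose e i (v : 'cV[R]_(ck_n i)) : 'cV[R]_(\sum_i @ck_n R n C i) :=
  \mxcol_j (if i =P j is ReflectT E then
     castmx (congr1 (@ck_n R n C) E, erefl) v else 0).
have ei i v : submxcol (e i v) i = v.
  rewrite mxcolK; case: eqP => // E.
  by rewrite (eq_irrelevance E erefl) castmx_id.
have ej i j v : i != j -> submxcol (e i v) j = 0.
  by rewrite mxcolK; case: eqP.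
have Me i j v : submxcol (M *m e j v) i = submxblock M i j *m v.
  rewrite -[M in LHS]submxblockK -[e j v]submxcolK mul_mxblock_mxrow mxcolK.
  rewrite (bigD1 j) //= ei big1 ?addr0 // => k kj.
  by rewrite ej ?mulmx0 // eq_sym.
have eA i v : B *m e i v \in ck_A C i.
  apply/PA => j ji; rewrite mulmxA PB mul1mx ej //.
  by apply: contraTneq ji => ->; rewrite ltnn.
have Psig i v : P *m sigma (B *m e i v) = M *m e i v.
  by rewrite -MP; congr (M *m _); rewrite mulmxA PB mul1mx.
exists M; split.
- move=> X x y Xx sXy; have := involution_symmetry inv Xx.
  rewrite sXy => E; have /vlineP[c yE] : y \in <[sigma x]>%VS.
    by rewrite -E memv_line.
  exists c; last by rewrite MP yE scalemxAr.
  apply: contraTneq (valP (s X)) => c0; rewrite /= sXy yE c0 scale0r.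
  by rewrite dim_vline eqxx.
- move=> i j ij; apply: mulmx_cV_inj => v; rewrite mul0mx -Me -Psig.
  by move: i ij; apply/PA/symA; rewrite ?eA // -ltnS.
move=> i U; apply: mulmx_bilinear_inj => u v.
have ir : (i <= ck_r C)%N by rewrite -ltnS.
have [c cn0 fE] := Pf i.
have := symf (x := Subvs (eA i u)) (x' := Subvs (symA ir (eA i u)))
  (y := Subvs (eA i v)) (y' := Subvs (symA ir (eA i v))) ir erefl erefl.
rewrite !fE /= !Psig !Me !(mulmxA P) PB !mul1mx !ei => /(mulfI cn0).
by rewrite trmx_mul !mulmxA.
Qed.

End Reflection.

Theorem theorem5p3 (R : realType) (n : nat) (C : cayley_klein R n)
    (s : point R n -> point R n) :
  is_reflection C s -> is_motion C s.
Proof.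
move=> [K [K' [KK' tpK _ inv]]]; have [_ _ KK0 _] := KK'.
have dec i x : (i <= ck_r C)%N -> x \in ck_A C i ->
    exists k k', [/\ k \in K, k' \in K', k \in ck_A C i, k' \in ck_A C i
                 & x = k + k'].
  move=> ir xA; have [dA _] := total_polar_level KK0 tpK ir.
  have : x \in (K :&: ck_A C i + K' :&: ck_A C i)%VS.
    suff -> : (K :&: ck_A C i + K' :&: ck_A C i)%VS = ck_A C i by [].
    apply/eqP; rewrite eqEdim subv_add !capvSr /=.
    rewrite dimv_disjoint_sum //; apply/eqP; rewrite -subv0 -KK0.
    by apply: capvS; apply: capvSl.
  case/memv_addP => k /[!memv_cap]/andP[kK kA].
  case=> k' /[!memv_cap]/andP[k'K k'A] ->.
  by exists k, k'.
have symA i x : (i <= ck_r C)%N -> x \in ck_A C i ->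
    symmetry K K' x \in ck_A C i.
  move=> ir /(dec _ _ ir)[k [k' [kK kK' kA k'A ->]]].
  by rewrite symmetryE // rpredB.
apply: (symmetry_motion (K := K) (K' := K')) => // i x x' y y' ir x'E y'E.
have [_ fconj] := total_polar_level KK0 tpK ir.
have [k [k' [kK kK' kA k'A xE]]] := dec _ _ ir (subvsP x).
have [m [m' [mK mK' mA m'A yE]]] := dec _ _ ir (subvsP y).
have -> : x = Subvs kA + Subvs k'A by apply/val_inj.
have -> : x' = Subvs kA - Subvs k'A.
  by apply/val_inj; rewrite /= x'E xE symmetryE.
have -> : y = Subvs mA + Subvs m'A by apply/val_inj.
have -> : y' = Subvs mA - Subvs m'A.
  by apply/val_inj; rewrite /= y'E yE symmetryE.
(* The mixed terms vanish by conjugacy, and the two signs in the K' term cancel. *)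
rewrite !(linearDl, linearDr) !(linearNl, linearNr) /=.
have k'm : ck_f C i (Subvs k'A) (Subvs mA) = 0.
  by rewrite hermC expr0 mul1r fconj.
by rewrite k'm (fconj (Subvs kA) (Subvs m'A)) // !oppr0 !addr0 !add0r opprK.
Qed.
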